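(* Let $\mathsf x\in\mathfrak{gl}_n(\mathbb C)$. The singular locus of $\mathcal B(\mathsf x,H(\mathbf m_{\mathbf{max}}))$ is contained in $\mathcal B(\mathsf x,H((1,n-1,\dots,n-1,n)))$. If $\mathsf x\in\mathfrak{gl}_n(\mathbb C)$ is nilpotent, then this containment is an equality.
   Context: Let $n$ be a positive integer, $G=GL_n(\mathbb C)$, and $B\subseteq G$ the subgroup of upper triangular matrices. A Hessenberg vector is a weakly increasing sequence $\mathbf m=(\mathbf m(1),\dots,\mathbf m(n))$ in $\{1,\dots,n\}$ with $\mathbf m(i)\ge i$ for all $i$; $H(\mathbf m)$ is the space of matrices $\mathsf a=(\mathsf a_{ij})\in\mathfrak{gl}_n(\mathbb C)$ with $\mathsf a_{ij}=0$ whenever $i>\mathbf m(j)$. Then $\mathcal B(\mathsf x,H(\mathbf m))=\{gB\in G/B\mid g^{-1}\mathsf xg\in H(\mathbf m)\}$, a closed subvariety of the flag variety $G/B$; equivalently, it is the set of full flags $V_\bullet$ in $\mathbb C^n$ with $\mathsf xV_i\subseteq V_{\mathbf m(i)}$ for all $i$. Here $\mathbf m_{\mathbf{max}}=(n-1,n,\dots,n)$, and $(1,n-1,\dots,n-1,n)$ is the Hessenberg vector of length $n$ with first entry $1$, last entry $n$, and all other entries $n-1$.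
   Formalization: The equality for nilpotent x is stated only for x nonzero and n at least 3: for x = 0 the variety is all of G/B, which is smooth, and for n = 2, x nonzero it is a single reduced (smooth) point, so equality fails; for n = 1, m_max = (0) is not a Hessenberg vector. *)

(* Defs.v *)
From mathcomp Require Import all_boot all_order all_algebra.
From mathcomp Require Import ring_quotient.
From mathcomp Require Import classical_sets reals complex mpoly.
From mathcomp Require Import zify.

Set Implicit Arguments.
Unset Strict Implicit.
Unset Printing Implicit Defensive.

Import GRing.Theory.

Local Open Scope classical_set_scope.
Local Open Scope ring_scope.

(* Regular and singular points of a closed algebraic subset Z of affine       *)
(* N-space with its reduced structure. Z need not be irreducible or           *)
(* equidimensional. Below, local_dim is the Krull dimension of the local ring *)
(* O_(Z,p) and tangent_dim the dimension of its Zariski tangent space, so     *)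
(* that a point is regular exactly when O_(Z,p) is a regular local ring.      *)
Section AffineVariety.
Variables (K : fieldType) (N : nat).
Implicit Types (Z : set 'rV[K]_N) (p : 'rV[K]_N).

Definition vanishing_ideal Z : set {mpoly K[N]} :=
  [set f | forall v, Z v -> f.@[v 0] = 0].

Definition prime_ideal (P : {pred {mpoly K[N]}}) : Prop :=
  idealr_closed P /\ prime_idealr_closed P.

(* The primes of O_(Z,p) are the primes of K[X_1, .., X_N] that contain I(Z)  *)
(* and are contained in the maximal ideal of p. The chain                     *)
(* P 0 < P 1 < .. < P d has length d; the values P k for k > d are irrelevant *)
Definition prime_chain Z p (d : nat) : Prop :=
  exists P : nat -> {pred {mpoly K[N]}},
    [/\ forall k, (k <= d)%N -> prime_ideal (P k),
        forall f, vanishing_ideal Z f -> f \in P 0%N,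
        forall f, f \in P d -> f.@[p 0] = 0
      & forall k, (k < d)%N ->
          {subset P k <= P k.+1} /\ exists2 f, f \in P k.+1 & f \notin P k].

Definition local_dim Z p (d : nat) : Prop :=
  prime_chain Z p d /\ forall e, prime_chain Z p e -> (e <= d)%N.

Definition tangent_space Z p : set 'rV[K]_N :=
  [set w | forall f, vanishing_ideal Z f ->
             \sum_(k < N) (f^`M(k)).@[p 0] * w 0 k = 0].

Definition tangent_dim Z p (d : nat) : Prop :=
  exists2 U : {vspace 'rV[K]_N},
    forall w, (w \in U) <-> tangent_space Z p w & \dim U = d.

Definition regular_point Z p : Prop :=
  Z p /\ exists d, local_dim Z p d /\ tangent_dim Z p d.

Definition singular_point Z p : Prop := Z p /\ ~ regular_point Z p.

End AffineVariety.

(* A point of the flag variety GL_n / B is a left coset g B, as a set of      *)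
(* matrices.                                                                  *)
Section FlagVariety.
Variables (K : fieldType) (n : nat).

Definition borel : set 'M[K]_n :=
  [set b | b \in unitmx /\ forall i j : 'I_n, (j < i)%N -> b i j = 0].

Definition flag (g : 'M[K]_n) : set 'M[K]_n := [set g *m b | b in borel].

Definition lower_pairs : pred ('I_n * 'I_n) :=
  [pred ij : 'I_n * 'I_n | (ij.2 < ij.1)%N].

(* Identification of affine space of dimension n(n-1)/2 with the group of     *)
(* lower unitriangular matrices, whose free entries are those strictly below  *)
(* the diagonal.                                                              *)
Definition lower_unip (v : 'rV[K]_#|lower_pairs|) : 'M[K]_n :=
  1%:M + \sum_(k < #|lower_pairs|)
           v 0 k *: delta_mx (enum_val k).1 (enum_val k).2.

(* For invertible g, the map v |-> g (lower_unip v) B is an isomorphism from  *)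
(* affine space onto an open neighbourhood of g B (the translate by g of the  *)
(* opposite big cell), and it maps 0 to g B. These charts define the          *)
(* structure of variety on the flag variety.                                  *)
Definition chart (g : 'M[K]_n) (X : set (set 'M[K]_n)) :
    set 'rV[K]_#|lower_pairs| :=
  [set v | X (flag (g *m lower_unip v))].

(* For a closed subvariety X; whether 0 is singular in the chart at g depends *)
(* only on the coset of g.                                                    *)
Definition singular_locus (X : set (set 'M[K]_n)) : set (set 'M[K]_n) :=
  [set flag g | g in [set g | g \in unitmx /\ singular_point (chart g X) 0]].

End FlagVariety.

(* Rows and columns are numbered from 0 by 'I_n, whereas a Hessenberg vector  *)
(* has its values in {1, .., n}: m i stands for the entry m(i + 1).           *)
Definition hessenberg_vector (n : nat) (m : 'I_n -> nat) : Prop :=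
  [/\ forall i : 'I_n, (m i <= n)%N,
      forall i : 'I_n, (i.+1 <= m i)%N
    & forall i j : 'I_n, (i <= j)%N -> (m i <= m j)%N].

Definition hess_space (K : fieldType) (n : nat) (m : 'I_n -> nat) :
    set 'M[K]_n :=
  [set a | forall i j : 'I_n, (m j < i.+1)%N -> a i j = 0].

Definition hess_variety (K : fieldType) (n : nat) (x : 'M[K]_n)
    (m : 'I_n -> nat) : set (set 'M[K]_n) :=
  [set flag g | g in
     [set g | g \in unitmx /\ hess_space m (invmx g *m x *m g)]].

(* (n-1, n, .., n) *)
Definition m_max (n : nat) (i : 'I_n) : nat :=
  if i == 0%N :> nat then n.-1 else n.

(* (1, n-1, .., n-1, n) *)
Definition m_sing (n : nat) (i : 'I_n) : nat :=
  if i == 0%N :> nat then 1%N else if i.+1 == n then n else n.-1.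

Lemma m_max_hessenberg (n : nat) : (1 < n)%N -> hessenberg_vector (@m_max n).
Proof.
rewrite /m_max => n_gt1; split=> [i|i|i j le_ij]; have := ltn_ord i.
- by case: eqP; lia.
- by case: eqP; lia.
- by have := ltn_ord j; do 2?case: eqP; lia.
Qed.

Lemma m_sing_hessenberg (n : nat) : (0 < n)%N -> hessenberg_vector (@m_sing n).
Proof.
rewrite /m_sing => n_gt0; split=> [i|i|i j le_ij]; have := ltn_ord i.
- by do 2?case: eqP; lia.
- by do 2?case: eqP; lia.
- by have := ltn_ord j; do 4?case: eqP; lia.
Qed.

(* Main.v *)
Require Import Defs.
From mathcomp Require Import all_boot all_order all_algebra.
From mathcomp Require Import boolp classical_sets reals complex mpoly.
From mathcomp Require Import zify ring.

(** Fix a point g B and put A = g^-1 x g. In the chart at g B, whose points are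
the lower unitriangular matrices L, the first variety is the zero set of the
single polynomial f(L) = lower left corner of L^-1 A L, because the condition
x V_1 <= V_(n-1) only sees that corner. The point g B lies on the second
variety when the first column and the last row of A vanish off the diagonal.
Let N = n(n-1)/2 be the dimension of the chart; numbering rows and columns from
0, call an index k with 0 < k < n-1 a middle index.

Regular points. If g B is on the first variety but not on the second, then
A k 0 <> 0 or A (n-1) k <> 0 for some middle k. Multiplying L on the right by
1 + t E_pq, with (p, q) = (n-1, k) or (k, 0) respectively, lets the additive
group act on the chart, and f is affine in t along the orbits, with slope
- (L^-1 A L) k 0, respectively (L^-1 A L) (n-1) k, which does not vanish at
L = 1. So near the base point every orbit meets f = 0 exactly once, and f = 0
is the graph of a rational map over the slice where the coordinate (p, q) is 0
([slice_regular_point]). Pulling back the coordinate subspaces of the slice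
gives a chain of primes of length N-1; clearing denominators shows that a
function vanishing on f = 0 is, up to a factor that is invertible at the base
point, a multiple of f, so that the tangent space is the kernel of df.

Length of chains. A strict chain of primes of K[X_1, .., X_N] has length at
most N ([krull_dim_mpoly]): otherwise choose N+1 elements, the i-th one in the
(i+1)-st prime and not in the i-th; they are algebraically dependent, by
counting monomials, and following the lexicographically lowest term of a
dependence up the chain puts a nonzero constant in a prime. So the primes that
contain some fixed f <> 0 form chains of length at most N-1.

Singular points. If x is nilpotent and g B is on the second variety, then the
first column and the last row of A are zero, and df = 0 at the base point. This
is not enough: a function vanishing on f = 0 need not be a multiple of f. But
every direction of the chart turns out to be tangent at the base point to
curves lying in f = 0. Those E_ij that are not the corner span lines contained
in f = 0; the direction of the corner comes from a line, or, when the first row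
and the last column of A vanish at the middle indices, from a parabola together
with its tangent line ([differential_corner]). Hence the tangent space has
dimension N, whereas the local ring has dimension less than N because f <> 0
([corner_nonzero]). *)

Set Implicit Arguments.
Unset Strict Implicit.
Unset Printing Implicit Defensive.

Import GRing.Theory Num.Theory.

Local Open Scope classical_set_scope.
Local Open Scope ring_scope.
Local Open Scope complex_scope.

(** * Krull dimension of polynomial rings *)

Section KrullDimension.
Variables (K : fieldType) (N : nat).
Local Notation A := {mpoly K[N]}.

Lemma prime_idealD (P : {pred A}) u v :
  prime_ideal P -> u \in P -> v \in P -> u + v \in P.
Proof. by case=> [[_ _ cP] _] uP vP; rewrite -[u]mul1r; apply: cP. Qed.

Lemma prime_idealMl (P : {pred A}) a u : prime_ideal P -> u \in P -> a * u \in P.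
Proof. by case=> [[P0 _ cP] _] uP; rewrite -[_ * _]addr0; apply: cP. Qed.

Lemma prime_idealM (P : {pred A}) u v :
  prime_ideal P -> u * v \in P -> u \notin P -> v \in P.
Proof. by case=> _ prP /prP /orP[->|]. Qed.

Lemma prime_ideal_addKr (P : {pred A}) u v :
  prime_ideal P -> u + v \in P -> v \in P -> u \in P.
Proof.
move=> prP uvP vP; rewrite -[u](addrK v); apply: prime_idealD => //.
by rewrite -mulN1r; apply: prime_idealMl.
Qed.

Lemma prime_ideal0 : prime_ideal (pred1 (0 : A)).
Proof.
split; last by move=> u v; rewrite !inE mulf_eq0.
split=> [||a u v]; rewrite !inE ?oner_eq0 //.
by move=> /eqP-> /eqP->; rewrite mulr0 addr0.
Qed.

(** Modulo P the element x is regular, so it can be cancelled until the lowest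
nonzero coefficient becomes the constant term; the other terms are then
multiples of x and hence in Q. *)
Lemma lowest_coef_in_prime (P Q : {pred A}) x :
  prime_ideal P -> prime_ideal Q -> {subset P <= Q} -> x \in Q -> x \notin P ->
  forall M (F : nat -> A), \sum_(b < M) x ^+ b * F b \in P ->
  forall a, (a < M)%N -> (forall b, (b < a)%N -> F b = 0) -> F a \in Q.
Proof.
move=> prP prQ sPQ xQ xP; elim=> [|M IHM] F //.
rewrite big_ord_recl expr0 mul1r.
under eq_bigr do rewrite exprS -mulrA.
rewrite -mulr_sumr => sumP [_ _|a lt_aM F0].
  apply: (prime_ideal_addKr prQ (sPQ _ sumP)).
  by rewrite mulrC; apply: prime_idealMl.
apply: (IHM (F \o S)) => //=; last by move=> b lt_ba; apply: F0.
by move: sumP; rewrite F0 // add0r => sumP; apply: (prime_idealM prP sumP).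
Qed.

(** Exponent vectors of length k with entries below M, as nested pairs: the
recursion separates the first variable from the others, which is the shape of
the induction in [prime_chain_independent]. *)
Fixpoint exponents (M k : nat) : finType :=
  if k is k'.+1 then ('I_M * exponents M k')%type : finType else unit : finType.

Fixpoint monomial (M k : nat) (x : nat -> A) : exponents M k -> A :=
  match k return exponents M k -> A with
  | 0 => fun=> 1
  | k'.+1 => fun e => x 0%N ^+ e.1 * monomial (x \o S) e.2
  end.

Lemma card_exponents M k : #|exponents M k| = (M ^ k)%N.
Proof. by elim: k => [|k IHk]; rewrite ?card_unit // card_prod card_ord IHk expnS. Qed.

(** A relation in Q 0 is a polynomial in x 0 whose coefficients are combinations
of monomials in x 1, .., x (k-1). Its lowest coefficient lies in Q 1 by
[lowest_coef_in_prime], and is by induction on k the zero combination; so no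
coefficient can be the lowest nonzero one. *)
Lemma prime_chain_independent (M k : nat) (Q : nat -> {pred A}) (x : nat -> A)
    (c : exponents M k -> K) :
  (forall i, (i <= k)%N -> prime_ideal (Q i)) ->
  (forall i, (i < k)%N ->
     [/\ {subset Q i <= Q i.+1}, x i \in Q i.+1 & x i \notin Q i]) ->
  \sum_e c e *: monomial x e \in Q 0%N -> forall e, c e = 0.
Proof.
elim: k => [|k IHk] in Q x c *.
  move=> prQ _ + [] /=; have [[Q0 Q1 cQ] _] := prQ 0%N isT.
  rewrite (big_pred1 tt) => [cQ0|[] //].
  apply: contraNeq Q1 => nz_c; rewrite -[1]scale1r -(mulVf nz_c) -scalerA.
  by rewrite -mul_mpolyC -[_ * _]addr0; apply: cQ.
move=> prQ incQ; have [sQ xQ1 xQ0] := incQ 0%N isT.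
rewrite (eq_bigr (fun e : 'I_M * exponents M k =>
    x 0%N ^+ e.1 * (c (e.1, e.2) *: monomial (x \o S) e.2)));
  last by case=> b e _ /=; rewrite scalerAr.
rewrite -(pair_bigA _ (fun (b : 'I_M) e => x 0%N ^+ b * (c (b, e) *: monomial (x \o S) e))) /=.
under eq_bigr do rewrite -mulr_sumr.
pose F b := if insub b is Some b' then \sum_e c (b' : 'I_M, e) *: monomial (x \o S) e else 0.
rewrite (eq_bigr (fun b : 'I_M => x 0%N ^+ b * F b)); last by move=> b _; rewrite /F valK.
move=> sumQ [b e]; have [m lt_bm] := ubnP (b : nat); elim: m => // m IHm in b e lt_bm *.
have F0 b' : (b' < b)%N -> F b' = 0.
  rewrite /F; case: insubP => // b'' _ <- lt_b; apply: big1 => e' _.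
  by rewrite IHm ?scale0r //; apply: leq_trans lt_b _.
have := lowest_coef_in_prime (prQ 0%N isT) (prQ 1%N isT) sQ xQ1 xQ0 sumQ (ltn_ord b) F0.
rewrite /F valK => FbQ.
by apply: (IHk (Q \o S) (x \o S) (fun e => c (b, e))) => //= i ltik; [apply: prQ|apply: incQ].
Qed.

Lemma msizeM_bound (p q : A) a b :
  (msize p <= a.+1)%N -> (msize q <= b.+1)%N -> (msize (p * q) <= (a + b).+1)%N.
Proof.
have [->|nz_p] := eqVneq p 0; first by rewrite mul0r msize0.
have [->|nz_q] := eqVneq q 0; first by rewrite mulr0 msize0.
move=> szp szq; rewrite msizeM // -subn1 leq_subLR.
by apply: leq_trans (leq_add szp szq) _; rewrite addSn addnS.
Qed.

Lemma monomial_size M k (x : nat -> A) D (e : exponents M k) :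
  (forall i, (msize (x i) <= D.+1)%N) -> (msize (monomial x e) <= (k * M * D).+1)%N.
Proof.
have sizeX y m : (msize y <= D.+1)%N -> (msize (y ^+ m : A) <= (m * D).+1)%N.
  move=> szy; elim: m => [|m IHm]; first by rewrite expr0 msize1.
  by rewrite exprS mulSn; apply: msizeM_bound.
elim: k => [|k IHk] in x e * => szx; first by rewrite msize1.
case: e => b e /=; rewrite mulSn mulnDl; apply: msizeM_bound; last by apply: IHk => i; apply: szx.
apply: leq_trans (sizeX _ b (szx 0%N)) _.
by rewrite ltnS leq_mul // ltnW // ltn_ord.
Qed.

Lemma card_bounded_monomials D : (#|{: 'X_{1..N < D}}| <= D ^ N)%N.
Proof.
case: D => [|D]; first by rewrite eq_card0 // => m; have := bmdeg m.
have -> : (D.+1 ^ N = #|{ffun 'I_N -> 'I_D.+1}|)%N by rewrite card_ffun !card_ord.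
pose f (m : 'X_{1..N < D.+1}) := [ffun i => inord (m i) : 'I_D.+1].
apply: (@leq_card _ _ f) => m m' /ffunP eq_f; apply/val_inj/mnmP => i /=.
have bound (p : 'X_{1..N < D.+1}) : (p i < D.+1)%N.
  by apply: leq_ltn_trans (bmdeg p); rewrite mdegE (bigD1 i) //= leq_addr.
by have := congr1 val (eq_f i); rewrite !ffunE /= !inordK.
Qed.

Lemma mcoeff_lin_comb (I : finType) (c : I -> K) (F : I -> A) m :
  (\sum_i c i *: F i)@_m = \sum_i c i * (F i)@_m.
Proof. by rewrite raddf_sum /=; apply: eq_bigr => i _; rewrite mcoeffZ. Qed.

(** The M^(N+1) monomials in N+1 elements of degree at most D have degree at most
(N+1) M D, so they lie in a space whose dimension is O(M^N); for M large they
are linearly dependent. *)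
Lemma algebraically_dependent (x : nat -> A) :
  exists M (c : exponents M N.+1 -> K),
    \sum_e c e *: monomial x e = 0 /\ exists e, c e != 0.
Proof.
pose D := (\max_(i < N.+1) msize (x i))%N.
have szx (i : 'I_N.+1) : (msize (x i) <= D.+1)%N.
  by apply: leqW; apply: (@leq_bigmax _ (fun i : 'I_N.+1 => msize (x i)) i).
(* Only the first N+1 entries of x occur; cutting x off bounds all degrees. *)
pose x' i := if (i < N.+1)%N then x i else 0.
have szx' i : (msize (x' i) <= D.+1)%N.
  rewrite /x'; case: ltnP => [lt_iN|_]; last by rewrite msize0.
  exact: (szx (Ordinal lt_iN)).
have eq_mon k M (y z : nat -> A) (e : exponents M k) :
    (forall i, (i < k)%N -> y i = z i) -> monomial y e = monomial z e.
  elim: k y z e => [//|k IHk] y z [b e] eqyz /=; rewrite eqyz //.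
  by congr (_ * _); apply: IHk => i ltik /=; apply: eqyz.
(* B bounds the degrees and is at most C * M, so that B^N < M^(N+1). *)
pose C := (N.+1 * D).+1; pose M := (C ^ N).+1.
pose B := (N.+1 * M * D).+1.
pose T := \matrix_(i < #|exponents M N.+1|, j < #|{: 'X_{1..N < B}}|)
   (monomial x (enum_val i))@_(enum_val j).
have ltT : (#|{: 'X_{1..N < B}}| < #|exponents M N.+1|)%N.
  apply: leq_ltn_trans (card_bounded_monomials B) _; rewrite card_exponents.
  have leB : (B <= C * M)%N by rewrite /B /C; lia.
  have [->|N0] := posnP N; first by rewrite expn0 expn1 /M ltnS expn_gt0.
  rewrite [(M ^ _)%N]expnS.
  apply: (@leq_ltn_trans ((C * M) ^ N)%N); first by rewrite leq_exp2r.
  by rewrite expnMn ltn_pmul2r // expn_gt0.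
have : kermx T != 0.
  rewrite -mxrank_eq0 mxrank_ker subn_eq0 -ltnNge.
  by apply: leq_ltn_trans (rank_leq_col _) ltT.
case/rowV0Pn => u /sub_kermxP uT u0.
exists M, (fun e => u 0 (enum_rank e)); split; last first.
  have /existsP[i ui] : [exists i, u 0 i != 0].
    apply: contraNT u0 => /existsPn u0; apply/eqP/rowP => i; rewrite mxE.
    by apply/eqP; have := u0 i; rewrite negbK.
  by exists (enum_val i); rewrite enum_valK.
apply/mpolyP => m; rewrite mcoeff0 mcoeff_lin_comb.
have [ltm|gem] := ltnP (mdeg m) B; last first.
  apply: big1 => e _; rewrite (@memN_msupp_eq0 _ _ _ m) ?mulr0 //.
  apply: msize_mdeg_ge; apply: leq_trans gem.
  rewrite (@eq_mon _ _ _ x'); first by apply: monomial_size szx'.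
  by move=> i ltiN; rewrite /x' ltiN.
have := congr1 (fun v : 'rV_ _ => v 0 (enum_rank (BMultinom ltm))) uT.
rewrite !mxE => uT0; rewrite -[RHS]uT0 [RHS](reindex (@enum_rank (exponents M N.+1))) /=.
  by apply: eq_bigr => e _; rewrite !mxE !enum_rankK.
by apply: onW_bij; apply: enum_rank_bij.
Qed.

Lemma krull_dim_mpoly (Q : nat -> {pred A}) :
  (forall i, (i <= N.+1)%N -> prime_ideal (Q i)) ->
  ~ (forall i, (i <= N)%N ->
       {subset Q i <= Q i.+1} /\ exists2 f, f \in Q i.+1 & f \notin Q i).
Proof.
move=> prQ incQ.
have /choice[x xP] i : exists f, (i <= N)%N -> f \in Q i.+1 /\ f \notin Q i.
  by case: leqP => [/incQ[_ [f fQ nfQ]]|_]; [exists f | exists 0].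
have [M [c [sum0 [e]]]] := algebraically_dependent x.
rewrite (@prime_chain_independent _ _ Q x c) ?eqxx // => [i ltiN|].
  by have [[sQ _] [xQ nxQ]] := (incQ i ltiN, xP i ltiN); split.
by rewrite sum0; have [[]] := prQ 0%N isT.
Qed.

(** The zero ideal extends the chain at the bottom, as f is in its first prime. *)
Lemma prime_chain_hypersurface (Z : set 'rV[K]_N) p d f :
  vanishing_ideal Z f -> f != 0 -> prime_chain Z p d -> (d < N)%N.
Proof.
move=> fZ nz_f [P [prP vanP _ incP]]; rewrite ltnNge; apply/negP => leNd.
pose Q i : {pred A} := if i is i'.+1 then P i' else pred1 0.
apply: (@krull_dim_mpoly Q) => [[|i] lei|[|i] lei] /=.
- exact: prime_ideal0.
- by apply: prP; lia.
- split; last by exists f; [apply: vanP | rewrite inE].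
  by move=> g; rewrite inE => /eqP->; have [[]] := prP 0%N isT.
by apply: incP; lia.
Qed.

End KrullDimension.

(** * Differentials along lines and parabolas *)

(** Structural induction suited to statements on ring morphisms. *)
Lemma mpoly_gen_ind (K : comNzRingType) (N : nat) (P : {mpoly K[N]} -> Prop) :
  (forall c, P c%:MP) -> (forall i, P 'X_i) ->
  (forall p q, P p -> P q -> P (p + q)) -> (forall p q, P p -> P q -> P (p * q)) ->
  forall p, P p.
Proof.
move=> PC PX PD PP; elim/mpolyind => [|c m p _ _ Pp]; first by rewrite -mpolyC0.
apply: (PD) => //; rewrite -mul_mpolyC; apply: (PP) => //; rewrite mpolyXE_id.
apply: (big_ind P) => [|p1 p2|i _]; [exact: (PC 1) | exact: PP |].
by elim: (m i) => [|k IHk]; [exact: (PC 1) | rewrite exprS; apply: PP].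
Qed.

Section ChainRule.
Variables (K S : comNzRingType) (N : nat) (phi : {rmorphism K -> S}).
Implicit Types (h : {mpoly K[N]}) (gam : 'I_N -> {poly S}).

(** The polynomial in one variable obtained by restricting h to the curve gam. The
coefficients of gam may be in an extension phi : K -> S; S = {poly K} gives
surfaces parametrised by two variables. *)
Definition along_curve gam h : {poly S} := mmap (polyC \o phi) gam h.

Lemma along_curve_horner gam h s :
  (along_curve gam h).[s] = mmap phi (fun i => (gam i).[s]) h.
Proof.
rewrite /along_curve; elim/mpoly_gen_ind: h => [c|i|p q Pp Pq|p q Pp Pq].
- by rewrite !mmapC /= hornerC.
- by rewrite !mmapX !mmap1U.
- by rewrite !rmorphD /= hornerD Pp Pq.
by rewrite !rmorphM /= hornerM Pp Pq.
Qed.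

Lemma along_curve_coef1 gam h :
  (along_curve gam h)`_1 =
  \sum_(i < N) mmap phi (fun j => (gam j).[0]) h^`M(i) * (gam i)`_1.
Proof.
elim/mpoly_gen_ind: h => [c|i|p q Pp Pq|p q Pp Pq].
- rewrite /along_curve mmapC coefC /= big1 // => i _.
  by rewrite mderivC mmap0 mul0r.
- rewrite /along_curve mmapX mmap1U (bigD1 i) //= big1 ?addr0 => [|j ne_ji].
    by rewrite mderivX mnm1E eqxx scale1r -{1}[U_(i)%MM]add0m addmK mpolyX0 rmorph1 mul1r.
  by rewrite mderivX mnm1E eq_sym (negPf ne_ji) scale0r mmap0 mul0r.
- rewrite /along_curve mmapD coefD Pp Pq -big_split; apply: eq_bigr => i _.
  by rewrite mderivD mmapD mulrDl.
rewrite /along_curve rmorphM /= coefM big_ord_recl big_ord1 /= subn0 subnn.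
rewrite -!horner_coef0 !along_curve_horner Pp Pq mulr_sumr mulr_suml addrC -big_split.
apply: eq_bigr => i _ /=; rewrite mderivM mmapD !rmorphM /=; ring.
Qed.

End ChainRule.

Section Curves.
Variables (K : numFieldType) (N : nat).
Implicit Types (h : {mpoly K[N]}) (w p : 'rV[K]_N).

Definition differential h p w : K := \sum_(i < N) (h^`M(i)).@[p 0] * w 0 i.

Lemma poly_eq0_on_field (q : {poly K}) : (forall s, q.[s] = 0) -> q = 0.
Proof.
move=> q0; apply/eqP/negPn/negP => nz_q.
have := max_poly_roots nz_q (rs := [seq i%:R | i <- iota 0 (size q)]).
rewrite size_map size_iota ltnn => H; apply: notF; apply: H.
  by apply/allP => s _; rewrite /root q0.
by rewrite map_inj_uniq ?iota_uniq // => i j /eqP; rewrite eqr_nat => /eqP.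
Qed.

Lemma differential_line h p w :
  differential h p w = (along_curve idfun (fun i => (p 0 i)%:P + w 0 i *: 'X) h)`_1.
Proof.
rewrite along_curve_coef1; apply: eq_bigr => i _; congr (_ * _).
  by apply: meval_eq => j; rewrite !hornerE.
by rewrite coefD coefC coefZ coefX mulr1 add0r.
Qed.

Lemma line_horner h p w s :
  (along_curve idfun (fun i => (p 0 i)%:P + w 0 i *: 'X) h).[s] = h.@[(p + s *: w) 0].
Proof.
rewrite along_curve_horner; apply: meval_eq => i.
by rewrite !mxE !hornerE mulrC.
Qed.

(** An affine function on K determines its slope since K is infinite. *)
Lemma differential_line_affine h p w a b :
  (forall s, h.@[(p + s *: w) 0] = a + s * b) -> differential h p w = b.
Proof.
move=> hE; rewrite differential_line.
set q := along_curve _ _ _; suff -> : q = a%:P + b *: 'X.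
  by rewrite coefD coefC coefZ coefX mulr1 add0r.
apply/eqP; rewrite -subr_eq0; apply/eqP/poly_eq0_on_field => s.
by rewrite hornerD hornerN line_horner hE !hornerE [b * s]mulrC subrr.
Qed.

(** For fixed t the polynomial s |-> h (t a + s w) vanishes at s = 0 and s = t^2.
Dividing by s leaves a polynomial in s and t that vanishes at s = t^2; at
t = s = 0 its value is the derivative of h in the direction w. *)
Lemma differential_parabola h (a w : 'rV[K]_N) :
  (forall t : K, h.@[(t *: a) 0] = 0) ->
  (forall t : K, h.@[(t *: a + t ^+ 2 *: w) 0] = 0) ->
  differential h 0 w = 0.
Proof.
move=> h_line h_par.
(* The outer variable is s and the inner one is t. *)
pose gam i : {poly {poly K}} := (a 0 i *: 'X)%:P + (w 0 i)%:P *: 'X.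
pose H := along_curve polyC gam h.
have HE (t : K) (s : {poly K}) : (H.[s]).[t] = h.@[(t *: a + s.[t] *: w) 0].
  rewrite /H along_curve_horner.
  rewrite -[mmap polyC _ h]/(along_curve idfun _ h) along_curve_horner.
  apply: meval_eq => i; rewrite !hornerE !mxE; ring.
have H0 : H.[0] = 0.
  by apply: poly_eq0_on_field => t; rewrite HE horner0 scale0r addr0.
have H2 : H.['X^2] = 0.
  by apply: poly_eq0_on_field => t; rewrite HE hornerXn.
have /factor_theorem[H1 HH1] : root H 0 by rewrite /root H0.
have : H1.['X^2] = 0.
  move/eqP: H2; rewrite HH1 hornerM mulf_eq0 => /orP[/eqP//|].
  by rewrite hornerXsubC subr0 expf_eq0 polyX_eq0.
have ev0 (p q : {poly K}) : p.[0] = q.[0] -> (H1.[p]).[0] = (H1.[q]).[0].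
  have E r : (H1.[r]).[0] = (map_poly (horner_eval 0) H1).[r.[0]].
    exact: esym (horner_map (horner_eval 0) H1 r).
  by move=> pq; rewrite !E pq.
move/(congr1 (horner^~ 0)); rewrite /= horner0 (ev0 _ 0); last first.
  by rewrite hornerXn horner0 expr0n.
have -> : H1.[0] = H`_1.
  by rewrite HH1 subr0 coefMX /= horner_coef0.
rewrite along_curve_coef1 horner_sum => <-; apply: eq_bigr => i _.
rewrite hornerM; congr (_ * _); last first.
  by rewrite coefD coefC coefZ coefX mulr1 add0r hornerC.
rewrite -[mmap polyC _ _]/(along_curve idfun _ _) along_curve_horner.
by apply: meval_eq => j; rewrite !hornerE !mxE.
Qed.

Lemma differentialB h1 h2 p w :
  differential (h1 - h2) p w = differential h1 p w - differential h2 p w.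
Proof. by rewrite -sumrB; apply: eq_bigr => i _; rewrite mderivB mevalB mulrBl. Qed.

Lemma differentialM h1 h2 p w :
  differential (h1 * h2) p w =
  h1.@[p 0] * differential h2 p w + differential h1 p w * h2.@[p 0].
Proof.
rewrite mulr_sumr mulr_suml -big_split; apply: eq_bigr => i _ /=.
rewrite mderivM mevalD !mevalM; ring.
Qed.

Lemma exists_nonroot (q : {poly K}) : q != 0 -> exists s, q.[s] != 0.
Proof.
move=> nz_q; apply: contrapT => no_s; case/eqP: nz_q; apply: poly_eq0_on_field => s.
by apply/eqP/negPn/negP => qs; apply: no_s; exists s.
Qed.

End Curves.

(** * Hypersurfaces transverse to an action of the additive group *)

Lemma hyperplane_dim (K : fieldType) N (c : 'cV[K]_N) : c != 0 ->
  exists2 U : {vspace 'rV[K]_N}, forall w, (w \in U) = (w *m c == 0) & \dim U = N.-1.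
Proof.
move=> nz_c; pose phi := linfun (mulmxr c : 'rV[K]_N -> 'rV[K]_1).
exists (lker phi); first by move=> w; rewrite memv_ker lfunE.
have := limg_ker_dim phi fullv; rewrite capfv dimvf dim_matrix.
suff -> : \dim (limg phi) = 1%N by rewrite addn1 mul1r => /(congr1 predn).
apply/eqP; rewrite eqn_leq; apply/andP; split.
  by rewrite -[X in (_ <= X)%N](dim_matrix K 1 1) -dimvf dimvS ?subvf.
rewrite lt0n dimv_eq0; apply: contra nz_c => /eqP img0; apply/eqP/row_matrixP => i.
rewrite rowE row0; apply/eqP; rewrite -memv0 -img0.
by have -> : delta_mx 0 i *m c = phi (delta_mx 0 i); [rewrite lfunE|rewrite memv_img ?memvf].
Qed.

(** Vector field on affine space with polynomial components B. *)
Definition velocity (K : fieldType) (N : nat) (B : 'I_N -> {mpoly K[N]}) (v : 'rV[K]_N) :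
  'rV[K]_N := \row_i (B i).@[v 0].

(** The field B generates an action of the additive group by
t, v |-> v + t *: velocity B v, as B is constant along the orbits. Since the
k-th component of B is 1, each orbit meets the slice v 0 k = 0 exactly once;
since f has slope a along the orbits, it also meets f = 0 exactly once where
a <> 0. So the part of the hypersurface f = 0 where a <> 0 is isomorphic to an
open subset of the slice. *)
Section Slice.
Variables (K : numFieldType) (N : nat) (f a : {mpoly K[N]}) (B : 'I_N -> {mpoly K[N]}).
Variable (k : 'I_N).
Implicit Types (h : {mpoly K[N]}) (v w : 'rV[K]_N).

Hypothesis f_flow : forall v t, f.@[(v + t *: velocity B v) 0] = f.@[v 0] + t * a.@[v 0].
Hypothesis B_flow : forall v t i, (B i).@[(v + t *: velocity B v) 0] = (B i).@[v 0].
Hypothesis B_k : forall v, (B k).@[v 0] = 1.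
Hypothesis f0 : f.@[(0 : 'rV[K]_N) 0] = 0.
Hypothesis a0 : a.@[(0 : 'rV[K]_N) 0] != 0.

(** The point of f = 0 on the orbit of v. *)
Definition retract v : 'rV[K]_N := v - (f.@[v 0] / a.@[v 0]) *: velocity B v.

Lemma f_retract v : a.@[v 0] != 0 -> f.@[(retract v) 0] = 0.
Proof. by move=> av; rewrite /retract -scaleNr f_flow mulNr divfK // subrr. Qed.

Lemma retract0 : retract 0 = 0.
Proof. by rewrite /retract f0 mul0r scale0r subr0. Qed.

(** The components of [retract] are rational with denominator a. Keeping track of
multiples of f makes the numerator congruent to a ^+ m * h modulo f, which
computes both the ideal of the hypersurface and its primes. *)
Lemma clear_denominators h : exists m g, forall v, a.@[v 0] != 0 ->
  (a ^+ m * h - f * g).@[v 0] = a.@[v 0] ^+ m * h.@[(retract v) 0].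
Proof.
elim/mpoly_gen_ind: h =>
  [c|i|p q [m1 [g1 IHp]] [m2 [g2 IHq]]|p q [m1 [g1 IHp]] [m2 [g2 IHq]]].
- by exists 0%N, 0 => v av; rewrite mulr0 subr0 !expr0 !mul1r !mevalC.
- exists 1%N, (B i) => v av; rewrite !expr1 mevalB !mevalM !mevalXU !mxE.
  by field.
- exists (m1 + m2)%N, (a ^+ m2 * g1 + a ^+ m1 * g2) => v av.
  transitivity ((a ^+ m2 * (a ^+ m1 * p - f * g1) + a ^+ m1 * (a ^+ m2 * q - f * g2)).@[v 0]).
    by congr (_.@[_]); rewrite exprD; ring.
  by rewrite mevalD !mevalM IHp // IHq // !rmorphXn /= mevalD exprD; ring.
exists (m1 + m2)%N, (g1 * a ^+ m2 * q + a ^+ m1 * p * g2 - f * g1 * g2) => v av.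
transitivity (((a ^+ m1 * p - f * g1) * (a ^+ m2 * q - f * g2)).@[v 0]).
  by congr (_.@[_]); rewrite exprD; ring.
by rewrite mevalM IHp // IHq // mevalM exprD; ring.
Qed.

Definition free_coords : seq 'I_N := [seq i <- enum 'I_N | i != k].

Definition slice (j : nat) : set 'rV[K]_N :=
  [set v | v 0 k = 0 /\ forall i, i \in take j free_coords -> v 0 i = 0].

(** Where a <> 0, the part of the hypersurface over the j-th coordinate subspace
of the slice is isomorphic to a nonempty open subset of a linear space, hence
irreducible, and it contains the base point: its ideal is a prime contained in
the maximal ideal of that point. *)
Definition slice_prime (j : nat) : {pred {mpoly K[N]}} :=
  fun h => `[< forall v, slice j v -> a.@[v 0] != 0 -> h.@[(retract v) 0] = 0 >].

Lemma slice_primeP j h :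
  reflect (forall v, slice j v -> a.@[v 0] != 0 -> h.@[(retract v) 0] = 0)
          (h \in slice_prime j).
Proof. exact: asboolP. Qed.

Lemma slice0 j : slice j 0.
Proof. by split=> [|i _]; rewrite mxE. Qed.

Lemma slice_line j v1 v2 t : slice j v1 -> slice j v2 -> slice j (v1 + t *: (v2 - v1)).
Proof.
move=> [v1k v1s] [v2k v2s]; split=> [|i i_s]; first by rewrite !mxE v1k v2k subrr mulr0 addr0.
by rewrite !mxE v1s // v2s // subrr mulr0 addr0.
Qed.

(** If each of two functions is nonzero at some point of the slice, then along the
line through both points the numerators of their pull-backs and a are nonzero
polynomials in one variable. A point of the line where none of the three
vanishes is one where the product of the two functions is nonzero. *)
Lemma slice_prime_ideal j : prime_ideal (slice_prime j).
Proof.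
split; first split.
- by apply/slice_primeP => v _ _; rewrite meval0.
- by apply/slice_primeP => /(_ 0 (slice0 j) a0) /eqP; rewrite meval1 oner_eq0.
- move=> g u1 u2 /slice_primeP u1P /slice_primeP u2P; apply/slice_primeP => v Lv av.
  by rewrite mevalD mevalM u1P // u2P // mulr0 addr0.
move=> h1 h2 /slice_primeP h12; apply/orP; apply: contrapT => /not_orP[h1P h2P].
have pt h : ~ h \in slice_prime j ->
    exists v, [/\ slice j v, a.@[v 0] != 0 & h.@[(retract v) 0] != 0].
  move=> nP; apply: contrapT => no_v; apply: nP; apply/slice_primeP => v Lv av.
  by apply/eqP/negPn/negP => hv; apply: no_v; exists v.
have [[v1 [L1 a1 hv1]] [v2 [L2 a2 hv2]]] := (pt _ h1P, pt _ h2P).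
have [m1 [g1 r1]] := clear_denominators h1.
have [m2 [g2 r2]] := clear_denominators h2.
pose line h := along_curve idfun (fun i => (v1 0 i)%:P + (v2 - v1) 0 i *: 'X) h.
have line0 h : h.@[v1 0] != 0 -> line h != 0.
  by apply: contraNneq => l0; have := line_horner h v1 (v2 - v1) 0;
    rewrite -/(line h) l0 horner0 scale0r addr0 => <-.
have line1 h : h.@[v2 0] != 0 -> line h != 0.
  by apply: contraNneq => l0; have := line_horner h v1 (v2 - v1) 1;
    rewrite -/(line h) l0 horner0 scale1r addrC subrK => <-.
have : line a * line (a ^+ m1 * h1 - f * g1) * line (a ^+ m2 * h2 - f * g2) != 0.
  rewrite !mulf_neq0 ?(line0 a) //.
    by apply: line0; rewrite r1 // mulf_neq0 ?expf_neq0.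
  by apply: line1; rewrite r2 // mulf_neq0 ?expf_neq0.
case/exists_nonroot => t; rewrite !hornerM !line_horner !mulf_eq0 !negb_or.
case/andP=> /andP[at_ h1t] h2t; move: h1t h2t; rewrite r1 // r2 // !mulf_eq0 !negb_or.
have := h12 _ (slice_line t L1 L2) at_; rewrite mevalM => /eqP.
by rewrite mulf_eq0 => /orP[]/eqP->; rewrite eqxx !andbF.
Qed.

Lemma size_free_coords : size free_coords = N.-1.
Proof.
have := count_predC (pred1 k) (enum 'I_N).
rewrite size_enum_ord count_uniq_mem ?enum_uniq // mem_enum /= -size_filter add1n.
by move/(congr1 predn) => <-; congr size; apply: eq_filter.
Qed.

(** Following the orbit back to the slice turns the i-th coordinate into the
polynomial 'X_i - 'X_k * B i, whose pull-back to the slice is the i-th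
coordinate again; it separates two successive primes. *)
Lemma slice_prime_lt j : (j < N.-1)%N ->
  {subset slice_prime j <= slice_prime j.+1} /\
  exists2 h, h \in slice_prime j.+1 & h \notin slice_prime j.
Proof.
rewrite -size_free_coords => ltj.
pose i := nth k free_coords j; have i_in : i \in free_coords by apply: mem_nth.
have ne_ik : i != k by move: i_in; rewrite mem_filter => /andP[].
have uniq_s : uniq free_coords by rewrite filter_uniq ?enum_uniq.
have takeS : take j.+1 free_coords = rcons (take j free_coords) i by rewrite (take_nth k).
split=> [h /slice_primeP hP|].
  apply/slice_primeP => v [vk vs]; apply: hP; split=> // i' i's; apply: vs.
  by rewrite takeS mem_rcons inE i's orbT.
have coordE v : v 0 k = 0 -> ('X_i - 'X_k * B i).@[(retract v) 0] = v 0 i.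
  move=> vk; rewrite mevalB mevalM !mevalXU.
  have -> : (B i).@[(retract v) 0] = (B i).@[v 0].
    by rewrite /retract -scaleNr B_flow.
  by rewrite !mxE vk B_k; ring.
exists ('X_i - 'X_k * B i).
  apply/slice_primeP => v [vk vs] av; rewrite coordE // vs //.
  by rewrite takeS mem_rcons inE eqxx.
pose w : 'rV[K]_N := delta_mx 0 i.
(* A point of the i-th axis, other than 0, where a does not vanish. *)
pose q := 'X * along_curve idfun (fun j => ((0 : 'rV[K]_N) 0 j)%:P + w 0 j *: 'X) a.
have /exists_nonroot[t] : q != 0.
  rewrite mulf_neq0 ?polyX_eq0 //; apply: contra a0 => /eqP q0.
  by have := line_horner a 0 w 0; rewrite q0 horner0 scale0r addr0 => <-.
rewrite hornerM hornerX line_horner add0r mulf_eq0 negb_or => /andP[nz_t at_].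
have wk : (t *: w) 0 k = 0 by rewrite !mxE eq_sym (negPf ne_ik) mulr0.
have Lw : slice j (t *: w).
  split=> // i' i's; rewrite !mxE eqxx /=; case: eqP => [eq_i'|]; last by rewrite mulr0.
  by have := take_uniq j.+1 uniq_s; rewrite takeS rcons_uniq -eq_i' i's.
apply/slice_primeP => /(_ _ Lw at_) /eqP.
by rewrite coordE // !mxE !eqxx mulr1 (negPf nz_t).
Qed.

Variable Z : set 'rV[K]_N.
Hypothesis ZE : forall v, Z v <-> f.@[v 0] = 0.

Lemma slice_prime_chain : prime_chain Z 0 N.-1.
Proof.
exists slice_prime; split.
- by move=> j _; apply: slice_prime_ideal.
- by move=> h hZ; apply/slice_primeP => v _ av; apply: hZ; apply/ZE/f_retract.
- by move=> h /slice_primeP /(_ 0 (slice0 _) a0); rewrite retract0.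
exact: slice_prime_lt.
Qed.

(** By [clear_denominators], a ^+ m * h - f * g vanishes where a does not, hence
on every line through 0 because a is nonzero at 0; now differentiate at 0,
where h and f vanish. *)
Lemma slice_vanishing_differential h w :
  vanishing_ideal Z h -> differential f 0 w = 0 -> differential h 0 w = 0.
Proof.
move=> hZ dfw.
have h0 : h.@[(0 : 'rV[K]_N) 0] = 0 by apply: hZ; apply/ZE.
have [m [g r]] := clear_denominators h.
suff : differential (a ^+ m * h - f * g) 0 w = 0.
  rewrite differentialB !differentialM dfw h0 f0 !(mulr0, mul0r, addr0) subr0.
  by move/eqP; rewrite mulf_eq0 rmorphXn /= expf_eq0 (negPf a0) andbF => /eqP.
apply: (@differential_line_affine _ _ _ _ _ 0) => s; rewrite mulr0 addr0.
pose line p := along_curve idfun (fun i => ((0 : 'rV[K]_N) 0 i)%:P + w 0 i *: 'X) p.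
have /eqP : line a * line (a ^+ m * h - f * g) = 0.
  apply: poly_eq0_on_field => t; rewrite hornerM !line_horner.
  have [->|nz_a] := eqVneq a.@[(0 + t *: w) 0] 0; first by rewrite mul0r.
  by rewrite r // [h.@[_]]hZ ?mulr0 //; apply/ZE/f_retract.
rewrite mulf_eq0 => /orP[/eqP la|/eqP lr]; last by rewrite -line_horner -/(line _) lr horner0.
by case/eqP: a0; have := line_horner a 0 w 0; rewrite -/(line a) la horner0 scale0r addr0.
Qed.

Lemma slice_differential_neq0 : differential f 0 (velocity B 0) = a.@[(0 : 'rV[K]_N) 0].
Proof.
by apply: (@differential_line_affine _ _ _ _ _ 0) => s; rewrite f_flow f0.
Qed.

Lemma slice_regular_point : regular_point Z 0.
Proof.
have N0 : (0 < N)%N := leq_ltn_trans (leq0n _) (ltn_ord k).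
have fZ : vanishing_ideal Z f by move=> v /ZE.
have nz_f : f != 0.
  apply: contra a0 => /eqP f_eq0; rewrite -slice_differential_neq0 f_eq0.
  by rewrite /differential big1 // => i _; rewrite mderiv0 meval0 mul0r.
split; first exact/ZE.
exists N.-1; split.
  split=> [|e /(prime_chain_hypersurface fZ nz_f)]; [exact: slice_prime_chain | lia].
pose c : 'cV[K]_N := \col_i (f^`M(i)).@[(0 : 'rV[K]_N) 0].
have cE w : (w *m c == 0) = (differential f 0 w == 0).
  have <- : (w *m c) 0 0 = differential f 0 w.
    by rewrite mxE; apply: eq_bigr => i _; rewrite mxE mulrC.
  apply/eqP/eqP => [->|wc0]; first by rewrite mxE.
  by apply/matrixP => i j; rewrite !ord1 wc0 mxE.
have [|U UE dimU] := @hyperplane_dim _ _ c.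
  apply: contra a0 => /eqP c0; rewrite -slice_differential_neq0 -cE c0.
  by rewrite mulmx0.
exists U => // w; rewrite UE cE; split=> [/eqP dfw h hZ|tw].
  exact: slice_vanishing_differential.
by apply/eqP; apply: tw.
Qed.

End Slice.

(** * Conjugation and flags *)

Section MatrixFacts.
Variables (K : fieldType) (n : nat).
Implicit Types (A L g : 'M[K]_n).

Definition conj_by A g : 'M[K]_n := invmx g *m A *m g.

Lemma invmx_unique (A B : 'M[K]_n) : B *m A = 1%:M -> invmx A = B.
Proof.
move=> BA1; have [_ uA] := mulmx1_unit BA1.
by rewrite -[invmx A]mul1mx -BA1 mulmxK.
Qed.

Lemma invmxM (A B : 'M[K]_n) : A \in unitmx -> B \in unitmx ->
  invmx (A *m B) = invmx B *m invmx A.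
Proof. by move=> uA uB; apply: invmx_unique; rewrite mulmxA mulmxKV // mulVmx. Qed.

Lemma conj_byM A g h : g \in unitmx -> h \in unitmx ->
  conj_by A (g *m h) = conj_by (conj_by A g) h.
Proof. by move=> ug uh; rewrite /conj_by invmxM // !mulmxA. Qed.

Lemma mulmx_deltaE m (A : 'M[K]_(m, n)) p q i j :
  (A *m (delta_mx p q : 'M_n)) i j = A i p * (j == q)%:R.
Proof.
rewrite mxE (bigD1 p) //= mxE eqxx /= big1 ?addr0 // => k ne_kp.
by rewrite mxE (negPf ne_kp) mulr0.
Qed.

Lemma delta_mulmxE m (A : 'M[K]_(n, m)) p q i j :
  ((delta_mx p q : 'M_n) *m A) i j = (i == p)%:R * A q j.
Proof.
rewrite mxE (bigD1 q) //= mxE eqxx andbT big1 ?addr0 // => k ne_kq.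
by rewrite mxE (negPf ne_kq) andbF mul0r.
Qed.

Definition transvection (p q : 'I_n) (t : K) : 'M[K]_n := 1%:M + t *: delta_mx p q.

Lemma mulmx_transvectionE m (A : 'M[K]_(m, n)) p q t i j :
  (A *m transvection p q t) i j = A i j + t * A i p * (j == q)%:R.
Proof. by rewrite mulmxDr mulmx1 -scalemxAr 2!mxE mulmx_deltaE mulrA. Qed.

Lemma transvection_mulmxE m (A : 'M[K]_(n, m)) p q t i j :
  (transvection p q t *m A) i j = A i j + t * (i == p)%:R * A q j.
Proof. by rewrite mulmxDl mul1mx -scalemxAl 2!mxE delta_mulmxE mulrA. Qed.

Lemma transvection_inv p q t : p != q ->
  transvection p q t \in unitmx /\ invmx (transvection p q t) = transvection p q (- t).
Proof.
move=> ne_pq; have inv : transvection p q (- t) *m transvection p q t = 1%:M.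
  apply/matrixP => i j; rewrite mulmx_transvectionE !mxE (negPf ne_pq) andbF.
  by case: (i == p) (j == q) => [] [] /=; ring.
by split; [have [] := mulmx1_unit inv | exact: invmx_unique].
Qed.

Lemma conj_by_transvectionE A p q t i j : p != q ->
  conj_by A (transvection p q t) i j =
  A i j + t * A i p * (j == q)%:R
  - t * (i == p)%:R * (A q j + t * A q p * (j == q)%:R).
Proof.
move=> ne_pq; rewrite /conj_by (transvection_inv t ne_pq).2.
rewrite mulmx_transvectionE !transvection_mulmxE; ring.
Qed.

(** Monotonicity of m says that the Hessenberg space is stable under left and
right multiplication by upper triangular matrices. *)
Lemma hess_space_conj A b (m : 'I_n -> nat) :
  (forall i j : 'I_n, (i <= j)%N -> (m i <= m j)%N) ->
  borel b -> borel (invmx b) -> hess_space m A -> hess_space m (conj_by A b).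
Proof.
move=> mono_m [_ b_up] [_ ib_up] hA i j lt_ji; rewrite mxE big1 // => k _.
have [le_kj|lt_jk] := leqP k j; last by rewrite b_up ?mulr0.
rewrite mxE big1 ?mul0r // => k' _.
have [lt_k'i|le_ik'] := ltnP k' i; first by rewrite ib_up ?mul0r.
rewrite hA ?mulr0 //; apply: leq_trans (leq_ltn_trans (mono_m _ _ le_kj) lt_ji) _.
exact: le_ik'.
Qed.

Lemma borel1 : @borel K n 1%:M.
Proof.
split=> [|i j lt_ji]; first exact: unitmx1.
by rewrite mxE; case: eqP lt_ji => // ->; rewrite ltnn.
Qed.

Lemma flag_eq g g' : g \in unitmx -> flag g = flag g' ->
  exists b, [/\ borel b, borel (invmx b) & g' = g *m b].
Proof.
move=> ug eqf.
have [b bb gb] : flag g g' by rewrite eqf; exists 1%:M; [exact: borel1 | rewrite mulmx1].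
have [b' bb' gb'] : flag g' g by rewrite -eqf; exists 1%:M; [exact: borel1 | rewrite mulmx1].
have b'b : b *m b' = 1%:M.
  by rewrite -[LHS](mulKmx ug) (mulmxA g) gb gb' mulVmx.
by exists b; rewrite (invmx_unique (mulmx1C b'b)).
Qed.

(** The right hand side depends on g B only, by [hess_space_conj]. *)
Lemma hess_varietyE (x : 'M[K]_n) (m : 'I_n -> nat) g :
  (forall i j : 'I_n, (i <= j)%N -> (m i <= m j)%N) -> g \in unitmx ->
  hess_variety x m (flag g) <-> hess_space m (conj_by x g).
Proof.
move=> mono_m ug; split=> [[g' [ug' hg']]|hg]; last by exists g.
case/(flag_eq ug') => b [bb bib ->]; rewrite conj_byM //; last by case: bb.
exact: hess_space_conj.
Qed.

End MatrixFacts.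

(** * Coordinates on the opposite big cell *)

Section Chart.
Variables (K : fieldType) (n : nat).
Local Notation N := #|@lower_pairs n|.
Implicit Types (v w : 'rV[K]_N) (M L : 'M[K]_n).

(** Coordinates of a matrix in the chart; entries on and above the diagonal are
forgotten. *)
Definition coords M : 'rV[K]_N := \row_c M (enum_val c).1 (enum_val c).2.

Definition lower_part v : 'M[K]_n :=
  \sum_(c < N) v 0 c *: delta_mx (enum_val c).1 (enum_val c).2.

Lemma lower_unip_part v : lower_unip v = 1%:M + lower_part v. Proof. by []. Qed.

Lemma lower_part_linear v w t : lower_part (v + t *: w) = lower_part v + t *: lower_part w.
Proof.
rewrite scaler_sumr -big_split; apply: eq_bigr => c _ /=.
by rewrite !mxE scalerDl scalerA.
Qed.

Lemma coords_linear M M' t : coords (M + t *: M') = coords M + t *: coords M'.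
Proof. by apply/rowP => c; rewrite !mxE. Qed.

Lemma lower_part_upper v (i j : 'I_n) : (i <= j)%N -> lower_part v i j = 0.
Proof.
move=> le_ij; rewrite summxE big1 // => c _; rewrite !mxE.
have : ((enum_val c).2 < (enum_val c).1)%N := enum_valP c.
case: (enum_val c) => i' j' /= lt_ji'.
case: eqP => [eqi|]; case: eqP => [eqj|] //=; rewrite ?mulr0 //.
by move: lt_ji'; rewrite -eqi -eqj ltnNge le_ij.
Qed.

Lemma lower_part_val v c : lower_part v (enum_val c).1 (enum_val c).2 = v 0 c.
Proof.
rewrite summxE (bigD1 c) //= !mxE !eqxx mulr1 big1 ?addr0 // => c' ne_c.
rewrite !mxE -[_ && _]/(enum_val c == enum_val c') (inj_eq enum_val_inj) eq_sym.
by rewrite (negPf ne_c) mulr0.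
Qed.

Lemma lower_part_coords M :
  (forall i j : 'I_n, (i <= j)%N -> M i j = 0) -> lower_part (coords M) = M.
Proof.
move=> M_low; apply/matrixP => i j; have [le_ij|lt_ji] := leqP i j.
  by rewrite lower_part_upper // M_low.
have ij_in : (i, j) \in @lower_pairs n by [].
have := lower_part_val (coords M) (enum_rank_in ij_in (i, j)).
by rewrite mxE enum_rankK_in.
Qed.

Lemma lower_unip_diag v i : lower_unip v i i = 1.
Proof. by rewrite lower_unip_part !mxE eqxx -/(lower_part v) lower_part_upper ?addr0. Qed.

Lemma lower_unip_upper v (i j : 'I_n) : (i < j)%N -> lower_unip v i j = 0.
Proof.
move=> lt_ij; rewrite lower_unip_part !mxE -/(lower_part v) lower_part_upper 1?ltnW // addr0.
by case: eqP lt_ij => // ->; rewrite ltnn.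
Qed.

Lemma lower_unip_det v : \det (lower_unip v) = 1.
Proof.
rewrite det_trig; first by apply: big1 => i _; exact: lower_unip_diag.
by apply/is_trig_mxP => i j; apply: lower_unip_upper.
Qed.

Lemma lower_unip_unit v : lower_unip v \in unitmx.
Proof. by rewrite unitmxE lower_unip_det unitr1. Qed.

Lemma lower_unip0 : lower_unip (0 : 'rV[K]_N) = 1%:M.
Proof. by rewrite /lower_unip big1 ?addr0 // => c _; rewrite mxE scale0r. Qed.

Lemma conj_by_lower_unip0 (A : 'M[K]_n) : conj_by A (lower_unip 0) = A.
Proof. by rewrite lower_unip0 /conj_by invmx1 mul1mx mulmx1. Qed.

(** The universal point of the chart. Its determinant is 1, so that its adjugate is
its inverse and the entries of L^-1 A L are polynomials in the coordinates. *)
Definition generic_unip : 'M[{mpoly K[N]}]_n :=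
  1%:M + \sum_(c < N) 'X_c *: delta_mx (enum_val c).1 (enum_val c).2.

Definition generic_conj (A : 'M[K]_n) : 'M[{mpoly K[N]}]_n :=
  \adj generic_unip *m map_mx (@mpolyC N K) A *m generic_unip.

Lemma generic_unip_eval v : map_mx (meval (v 0)) generic_unip = lower_unip v.
Proof.
rewrite map_mxD map_mx1 raddf_sum; congr (_ + _); apply: eq_bigr => c _ /=.
by rewrite map_mxZ map_delta_mx /= mevalXU.
Qed.

Lemma generic_conj_eval (A : 'M[K]_n) v i j :
  (generic_conj A i j).@[v 0] = conj_by A (lower_unip v) i j.
Proof.
have -> : conj_by A (lower_unip v) = map_mx (meval (v 0)) (generic_conj A).
  rewrite !map_mxM map_mx_adj !generic_unip_eval; congr (_ *m _ *m _).
    by apply: invmx_unique; rewrite mul_adj_mx lower_unip_det.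
  by apply/matrixP => i' j'; rewrite !mxE /= mevalC.
by rewrite [RHS]mxE.
Qed.

(** Right multiplication by 1 + t E_pq adds t times column p of L to column q; this
is the corresponding vector field in the coordinates of the chart. *)
Definition column_velocity (p q : 'I_n) (c : 'I_N) : {mpoly K[N]} :=
  if (enum_val c).2 == q then generic_unip (enum_val c).1 p else 0.

Lemma column_velocity_eval p q v c : (column_velocity p q c).@[v 0] =
  lower_unip v (enum_val c).1 p * ((enum_val c).2 == q)%:R.
Proof.
rewrite /column_velocity; case: eqP => _; last by rewrite meval0 mulr0.
by rewrite mulr1 -generic_unip_eval [RHS]mxE.
Qed.

Lemma column_flow (p q : 'I_n) v t : (q < p)%N ->
  lower_unip (v + t *: velocity (column_velocity p q) v) = lower_unip v *m transvection p q t.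
Proof.
move=> lt_qp; rewrite !lower_unip_part lower_part_linear -lower_unip_part.
rewrite mulmxDr mulmx1 addrA -lower_unip_part -scalemxAr; congr (_ + _ *: _).
have -> : velocity (column_velocity p q) v = coords (lower_unip v *m delta_mx p q).
  by apply/rowP => c; rewrite mxE [RHS]mxE column_velocity_eval -mulmx_deltaE.
apply: lower_part_coords => i j le_ij; rewrite mulmx_deltaE.
case: eqP => [eq_jq|]; last by rewrite mulr0.
by rewrite lower_unip_upper ?mul0r // (leq_ltn_trans le_ij) // eq_jq.
Qed.

End Chart.

(** * Points where the first column or the last row does not vanish *)

Section Regular.
Variables (K : numFieldType) (n : nat) (o l k : 'I_n) (A : 'M[K]_n).
Hypotheses (o0 : o = 0%N :> nat) (l_last : l.+1 = n) (ne_ko : k != o) (ne_kl : k != l).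
Local Notation N := #|@lower_pairs n|.

Lemma corner_regular (p q : 'I_n) (a : {mpoly K[N]}) (Z : set 'rV[K]_N) :
  (q < p)%N ->
  (forall v t, conj_by A (lower_unip v *m transvection p q t) l o =
     conj_by A (lower_unip v) l o + t * a.@[v 0]) ->
  A l o = 0 -> a.@[(0 : 'rV[K]_N) 0] != 0 ->
  (forall v, Z v <-> conj_by A (lower_unip v) l o = 0) -> regular_point Z 0.
Proof.
move=> lt_qp flow Alo0 a0 ZE.
have pq_in : (p, q) \in @lower_pairs n by [].
apply: (@slice_regular_point _ _ (generic_conj A l o) a (column_velocity K p q)
  (enum_rank_in pq_in (p, q))) => [v t|v t c|v|||v].
- by rewrite !generic_conj_eval column_flow.
- rewrite !column_velocity_eval column_flow // mulmx_transvectionE.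
  by rewrite -[p == q]val_eqE gtn_eqF // mulr0 addr0.
- by rewrite column_velocity_eval enum_rankK_in // eqxx mulr1 lower_unip_diag.
- by rewrite generic_conj_eval conj_by_lower_unip0.
- exact: a0.
by rewrite generic_conj_eval.
Qed.

(** Conjugating C by 1 + t E_pq changes the corner by a quadratic polynomial in t.
Its quadratic term - t^2 C q p is absent unless (p, q) is the corner, and among
the linear terms only - t C k 0 remains for (p, q) = (n-1, k), and only
t C (n-1) k for (p, q) = (k, 0). *)
Lemma corner_regular_point (Z : set 'rV[K]_N) :
  A l o = 0 -> A k o != 0 \/ A l k != 0 ->
  (forall v, Z v <-> conj_by A (lower_unip v) l o = 0) -> regular_point Z 0.
Proof.
move=> Alo0 + ZE; have ne_lk : l != k by rewrite eq_sym.
case=> [Ako|Alk].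
  apply: (@corner_regular l k (- generic_conj A k o)) => //.
  - have : (k <= l)%N by have := ltn_ord k; lia.
    by rewrite leq_eqVlt val_eqE (negPf ne_kl).
  - move=> v t; rewrite conj_byM ?lower_unip_unit //; last first.
      by have [] := @transvection_inv K n l k t ne_lk.
    rewrite conj_by_transvectionE // mevalN generic_conj_eval.
    by rewrite [o == k]eq_sym (negPf ne_ko) eqxx /=; ring.
  by rewrite mevalN oppr_eq0 generic_conj_eval conj_by_lower_unip0.
apply: (@corner_regular k o (generic_conj A l k)) => //.
- by rewrite o0 lt0n -o0 val_eqE.
- move=> v t; rewrite conj_byM ?lower_unip_unit //; last first.
    by have [] := @transvection_inv K n k o t ne_ko.
  rewrite conj_by_transvectionE // generic_conj_eval.
  by rewrite (negPf ne_lk) eqxx /=; ring.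
by rewrite generic_conj_eval conj_by_lower_unip0.
Qed.

End Regular.

(** * Nilpotent matrices *)

Section Nilpotent.
Variables (K : fieldType) (n : nat).
Implicit Types A g : 'M[K]_n.

Lemma conj_by_exp A g m : g \in unitmx -> (conj_by A g) ^+ m = conj_by (A ^+ m) g.
Proof.
move=> ug; elim: m => [|m IHm]; first by rewrite !expr0 /conj_by mulmx1 mulVmx.
by rewrite !exprS IHm /conj_by -!mulmxE !mulmxA mulmxK.
Qed.

(** The basis vector at o is an eigenvector with eigenvalue A o o, which is zero
because A is nilpotent. *)
Lemma nilpotent_col A m (o : 'I_n) : A ^+ m = 0 ->
  (forall i, i != o -> A i o = 0) -> forall i, A i o = 0.
Proof.
move=> Am0 Acol; suff Aoo : A o o = 0 by move=> i; have [->//|/Acol] := eqVneq i o.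
have colE : A *m (delta_mx o 0 : 'cV_n) = A o o *: delta_mx o 0.
  apply/colP => i; rewrite -colE !mxE eqxx andbT.
  by have [->|/Acol->] := eqVneq i o; rewrite ?mulr1 ?mulr0.
have : A ^+ m *m (delta_mx o 0 : 'cV_n) = A o o ^+ m *: delta_mx o 0.
  elim: (m) => [|m' IHm]; first by rewrite !expr0 mul1mx scale1r.
  by rewrite exprSr -mulmxE -mulmxA colE -scalemxAr IHm scalerA exprS.
move/colP/(_ o); rewrite Am0 mul0mx !mxE !eqxx mulr1 => /esym/eqP.
by rewrite expf_eq0 => /andP[_ /eqP].
Qed.

Lemma nilpotent_row A m (l : 'I_n) : A ^+ m = 0 ->
  (forall j, j != l -> A l j = 0) -> forall j, A l j = 0.
Proof.
move=> Am0 Arow; suff All : A l l = 0 by move=> j; have [->//|/Arow] := eqVneq j l.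
have rowE' : (delta_mx 0 l : 'rV_n) *m A = A l l *: delta_mx 0 l.
  apply/rowP => j; rewrite -rowE !mxE eqxx /=.
  by have [->|/Arow->] := eqVneq j l; rewrite ?mulr1 ?mulr0.
have : (delta_mx 0 l : 'rV_n) *m A ^+ m = A l l ^+ m *: delta_mx 0 l.
  elim: (m) => [|m' IHm]; first by rewrite !expr0 mulmx1 scale1r.
  by rewrite exprS -mulmxE mulmxA rowE' -scalemxAl IHm scalerA exprS.
move/rowP/(_ l); rewrite Am0 mulmx0 !mxE !eqxx mulr1 => /esym/eqP.
by rewrite expf_eq0 => /andP[_ /eqP].
Qed.

(** The last nonzero vector among y, A y, A^2 y, ... *)
Lemma nilpotent_kernel (P : 'cV[K]_n -> Prop) A m :
  A ^+ m = 0 -> (forall y, P y -> P (A *m y)) ->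
  forall y, P y -> y != 0 -> exists y', [/\ P y', y' != 0 & A *m y' = 0].
Proof.
move=> Am0 stP y Py nz_y.
have : iter m (mulmx A) y = 0.
  have -> : iter m (mulmx A) y = A ^+ m *m y.
    elim: (m) => [|m' IHm]; first by rewrite expr0 mul1mx.
    by rewrite iterS IHm exprS -mulmxE mulmxA.
  by rewrite Am0 mul0mx.
elim: m {Am0} y Py nz_y => [|m IHm] y Py nz_y.
  by move=> /= y0; rewrite y0 eqxx in nz_y.
rewrite iterSr => itA0; have [Ay0|nz_Ay] := eqVneq (A *m y) 0; first by exists y.
exact: (IHm (A *m y) (stP _ Py) nz_Ay itA0).
Qed.

End Nilpotent.

(** * Points where the first column and the last row vanish *)

Section Singular.
Variables (K : numFieldType) (n : nat) (o l : 'I_n) (A : 'M[K]_n).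
Hypotheses (o0 : o = 0%N :> nat) (l_last : l.+1 = n) (ne_lo : l != o).
Hypotheses (Acol : forall i, A i o = 0) (Arow : forall j, A l j = 0).
Local Notation N := #|@lower_pairs n|.
Local Notation corner v := (conj_by A (lower_unip v) l o).

Definition middle_col (y : 'cV[K]_n) := y o 0 = 0 /\ y l 0 = 0.
Definition middle_row (eta : 'rV[K]_n) := eta 0 o = 0 /\ eta 0 l = 0.

(** The corner of L^-1 A L depends only on the first column of L and the last row
of L^-1, so test matrices L supported on the first column, the last row and the
diagonal are enough. *)
Definition hook (y : 'cV[K]_n) (eta : 'rV[K]_n) : 'M[K]_n :=
  y *m delta_mx 0 o + delta_mx l 0 *m eta.

Lemma hook_lower (y : 'cV_n) (eta : 'rV_n) s t (i j : 'I_n) :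
  middle_col y -> middle_row eta -> (i <= j)%N ->
  (s *: hook y eta + t *: delta_mx l o) i j = 0.
Proof.
move=> [yo yl] [eo el] le_ij; rewrite !mxE !big_ord1 !mxE.
rewrite eqxx /= andbT.
have [eq_jo|ne_jo] := eqVneq j o.
  have -> : i = o by apply/val_inj; move: le_ij; rewrite eq_jo /= o0; lia.
  by rewrite yo (eq_sym o l) (negPf ne_lo) /=; ring.
have [eq_il|ne_il] := eqVneq i l; last by rewrite /=; ring.
have -> : j = l by apply/val_inj; move: le_ij (ltn_ord j); rewrite eq_il /=; lia.
by rewrite el /=; ring.
Qed.

(** The corner is om A u, where u is the first column of L and om the last row of
L^-1, found by solving om L = last basis vector; here A u does not see the first
entry of u, and om A does not see the last entry of om. *)
Lemma hook_corner (y : 'cV_n) (eta : 'rV_n) s t :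
  middle_col y -> middle_row eta ->
  corner (s *: coords (hook y eta) + t *: coords (delta_mx l o)) =
  - s ^+ 2 * (eta *m A *m y) 0 0 - s * t * (eta *m A) 0 l
  + (s ^+ 2 * (eta *m y) 0 0 - t) * (s * (A *m y) o 0 + t * A o l).
Proof.
move=> my mr; case: (my) (mr) => [yo yl] [eo el].
have LE : lower_unip (s *: coords (hook y eta) + t *: coords (delta_mx l o)) =
    1%:M + (s *: hook y eta + t *: delta_mx l o).
  rewrite lower_unip_part; congr (_ + _).
  rewrite -[RHS]lower_part_coords; last by move=> i j; apply: hook_lower.
  by congr lower_part; apply/rowP => c; rewrite !mxE.
have := lower_unip_unit (s *: coords (hook y eta) + t *: coords (delta_mx l o)).
rewrite {}LE; set H := hook y eta; set L := 1%:M + _ => uL.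
pose ro : 'rV[K]_n := delta_mx 0 o; pose rl : 'rV[K]_n := delta_mx 0 l.
pose co : 'cV[K]_n := delta_mx o 0; pose cl : 'cV[K]_n := delta_mx l 0.
pose c := (eta *m y) 0 0.
pose om := rl - s *: eta + (s ^+ 2 * c - t) *: ro.
have deltaE : delta_mx l o = cl *m ro by rewrite mul_delta_mx.
have omy : om *m y = (- s * c)%:M.
  apply/rowP => j; rewrite !ord1 mulmxDl mulmxBl -!scalemxAl -rowE -rowE.
  rewrite !mxE yo yl eqxx mulr1n -[\sum_j _]/(\sum_j eta 0 j * y j 0).
  have -> : \sum_j eta 0 j * y j 0 = c by rewrite /c mxE.
  by ring.
have omcl : om *m cl = 1%:M.
  apply/rowP => j; rewrite !ord1 -colE !mxE el !eqxx (negPf ne_lo) /=; ring.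
have omL : om *m L = rl.
  rewrite /L mulmxDr mulmx1 mulmxDr -!scalemxAr deltaE mulmxA omcl mul1mx.
  rewrite /H /hook mulmxDr !mulmxA omy omcl mul1mx mul_scalar_mx.
  by apply/rowP => j; rewrite !mxE; ring.
have Lco : L *m co = co + s *: y + t *: cl.
  rewrite /L mulmxDl mul1mx mulmxDl -!scalemxAl mul_delta_mx /H /hook mulmxDl.
  rewrite -!mulmxA -(colE _ eta) addrA; congr (_ + _ *: _ + _).
  have -> : (delta_mx 0 o : 'rV_n) *m co = 1%:M.
    by rewrite mul_delta_mx; apply/rowP => j; rewrite !ord1 !mxE.
  rewrite mulmx1 [col _ _](_ : _ = 0) ?mulmx0 ?addr0 //.
  by apply/rowP => j; rewrite !mxE eo.
have -> : conj_by A L l o = (om *m A *m (L *m co)) 0 0.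
  rewrite -(mulmxK uL om) omL mulmxA -[rl *m _ *m _]mulmxA -[rl *m _ *m _]mulmxA -rowE -colE.
  by rewrite !mxE.
have rlA : rl *m A = 0 by rewrite -rowE; apply/rowP => j; rewrite !mxE Arow.
have Aco : A *m co = 0 by rewrite -colE; apply/colP => i; rewrite !mxE Acol.
have omA : om *m A = - s *: (eta *m A) + (s ^+ 2 * c - t) *: (ro *m A).
  by rewrite mulmxDl mulmxBl rlA -!scalemxAl sub0r scaleNr.
rewrite Lco !mulmxDr -[om *m A *m co]mulmxA Aco mulmx0 add0r -!scalemxAr -colE.
rewrite omA mulmxDl -!scalemxAl -(mulmxA ro) -!rowE -/c.
clearbody c; set u := eta *m A; set u' := A *m y; set d := (u *m y).
by rewrite !mxE; ring.
Qed.

Lemma differential_coordsD h (M M' : 'M[K]_n) t :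
  differential h 0 (coords (M + t *: M')) =
  differential h 0 (coords M) + t * differential h 0 (coords M').
Proof.
rewrite mulr_sumr -big_split; apply: eq_bigr => c _ /=; rewrite !mxE; ring.
Qed.

Section VanishingIdeal.
Variables (Z : set 'rV[K]_N) (h : {mpoly K[N]}).
Hypotheses (ZE : forall v, Z v <-> corner v = 0) (hZ : vanishing_ideal Z h).

(** The line of E_pq lies in the hypersurface: its square is zero, and the corner
of (1 - s E_pq) A (1 + s E_pq) is - s^2 times the corner of E_pq A E_pq, since
the first column and the last row of A are zero. *)
Lemma differential_entry (p q : 'I_n) : (q < p)%N -> (p, q) != (l, o) ->
  differential h 0 (coords (delta_mx p q)) = 0.
Proof.
move=> lt_qp ne_pq; apply: (@differential_line_affine _ _ _ _ _ 0) => s.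
rewrite mulr0 addr0; apply: hZ; apply/ZE.
have -> : lower_unip (0 + s *: coords (delta_mx p q)) = transvection p q s.
  rewrite lower_unip_part; congr (_ + _); rewrite -[RHS]lower_part_coords.
    by congr lower_part; apply/rowP => c; rewrite !mxE add0r.
  move=> i j le_ij; rewrite !mxE; case: eqP => [eq_i|]; last by rewrite mulr0.
  case: eqP => [eq_j|]; last by rewrite mulr0.
  by move: le_ij; rewrite eq_i eq_j leqNgt lt_qp.
rewrite conj_by_transvectionE; last by rewrite -val_eqE gtn_eqF.
rewrite !Acol !Arow !(mulr0, mul0r, add0r, addr0, sub0r).
have [eq_lp|] := eqVneq l p; last by rewrite /= !(mulr0, mul0r) oppr0.
have [eq_oq|] := eqVneq o q; last by rewrite /= !(mulr0, mul0r) oppr0.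
by rewrite eq_lp eq_oq eqxx in ne_pq.
Qed.

Lemma middle_lt (k : 'I_n) : k != o -> k != l -> (o < k)%N /\ (k < l)%N.
Proof.
rewrite -!val_eqE /= o0 => k0 kl; split; first by rewrite lt0n.
by have := ltn_ord k; move: kl; lia.
Qed.

Lemma middle_delta_col (k : 'I_n) a : k != o -> k != l -> middle_col (a *: delta_mx k 0).
Proof.
by move=> ko kl; split; rewrite !mxE eq_sym ?(negPf ko) ?(negPf kl) mulr0.
Qed.

Lemma middle_delta_row (k : 'I_n) a : k != o -> k != l -> middle_row (a *: delta_mx 0 k).
Proof.
by move=> ko kl; split; rewrite !mxE andTb eq_sym ?(negPf ko) ?(negPf kl) mulr0.
Qed.

Lemma differential_corner_line (y : 'cV_n) (eta : 'rV_n) :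
  middle_col y -> middle_row eta ->
  (forall s, corner (s *: coords (hook y eta) + s *: coords (delta_mx l o)) = 0) ->
  differential h 0 (coords (hook y eta)) = 0 ->
  differential h 0 (coords (delta_mx l o)) = 0.
Proof.
move=> my mr sZ dV0.
(* The hook is itself tangent, so it can be subtracted from the line. *)
suff : differential h 0 (coords (hook y eta + 1 *: delta_mx l o)) = 0.
  by rewrite differential_coordsD dV0 add0r mul1r.
apply: (@differential_line_affine _ _ _ _ _ 0) => s; rewrite mulr0 addr0 add0r.
by apply: hZ; apply/ZE; rewrite coords_linear scale1r scalerDr.
Qed.

(** By [hook_corner] with the last row zero, the line spanned by y and the corner is
in the hypersurface as soon as the entry o of A y is - A o l. *)
Lemma differential_corner_col (k : 'I_n) : k != o -> k != l -> A o k != 0 ->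
  differential h 0 (coords (delta_mx l o)) = 0.
Proof.
move=> ko kl Aok; pose y : 'cV[K]_n := (- A o l / A o k) *: delta_mx k 0.
have my : middle_col y by apply: middle_delta_col.
have mr : middle_row 0 by split; rewrite mxE.
apply: (differential_corner_line my mr) => [s|].
  rewrite hook_corner // !mul0mx !mxE (bigD1 k) //= big1 => [|i ne_ik].
    by rewrite !mxE !eqxx /=; field.
  by rewrite !mxE (negPf ne_ik) !mulr0.
have -> : hook y 0 = 0 + (- A o l / A o k) *: delta_mx k o.
  by rewrite /hook mulmx0 addr0 add0r -scalemxAl mul_delta_mx.
rewrite differential_coordsD differential_entry ?mulr0 ?addr0.
- by rewrite /differential big1 // => c _; rewrite !mxE mulr0.
- by have [] := middle_lt ko kl.
- by rewrite xpair_eqE (negPf kl).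
Qed.

(** The mirror image of [differential_corner_col], using the last column of A in
place of its first row. *)
Lemma differential_corner_row (k : 'I_n) : k != o -> k != l -> A k l != 0 ->
  differential h 0 (coords (delta_mx l o)) = 0.
Proof.
move=> ko kl Akl; pose eta : 'rV[K]_n := (- A o l / A k l) *: delta_mx 0 k.
have my : middle_col 0 by split; rewrite mxE.
have mr : middle_row eta by apply: middle_delta_row.
apply: (differential_corner_line my mr) => [s|].
  rewrite hook_corner // !mulmx0 -scalemxAl -rowE !mxE.
  by field.
have -> : hook 0 eta = 0 + (- A o l / A k l) *: delta_mx l k.
  by rewrite /hook mul0mx !add0r -scalemxAr mul_delta_mx.
rewrite differential_coordsD differential_entry ?mulr0 ?addr0.
- by rewrite /differential big1 // => c _; rewrite !mxE mulr0.
- by have [] := middle_lt ko kl.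
- by rewrite xpair_eqE (negPf ko) andbF.
Qed.

(** For y in the kernel of A, and eta supported at k with eta y = 1, the corner at
s *: hook y eta + t *: corner is (s^2 - t) t A o l: it vanishes on the line
t = 0 and on the parabola t = s^2. When A is supported at (o, l) these are in two
different components of the hypersurface, and no curve that is smooth at 0 and
tangent to the corner direction is available. *)
Lemma differential_corner_parabola (y : 'cV_n) (k : 'I_n) :
  middle_col y -> A *m y = 0 -> y k 0 != 0 -> A k l = 0 ->
  differential h 0 (coords (delta_mx l o)) = 0.
Proof.
move=> my Ay0 yk Akl.
have ko : k != o by apply: contraNneq yk => ->; rewrite (proj1 my).
have kl : k != l by apply: contraNneq yk => ->; rewrite (proj2 my).
pose eta : 'rV[K]_n := (y k 0)^-1 *: delta_mx 0 k.
have mr : middle_row eta by apply: middle_delta_row.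
have cornerE s t :
    corner (s *: coords (hook y eta) + t *: coords (delta_mx l o)) = (s ^+ 2 - t) * t * A o l.
  rewrite hook_corner // -mulmxA Ay0 mulmx0 -!scalemxAl -!rowE !mxE Akl.
  by rewrite mulVf //; ring.
apply: (@differential_parabola _ _ _ (coords (hook y eta))) => t; apply: hZ; apply/ZE.
  by rewrite -[X in lower_unip X]addr0 -(scale0r (coords (delta_mx l o))) cornerE; ring.
by rewrite cornerE; ring.
Qed.

(** If the first row of A vanishes at the middle indices, then A preserves the
span of the middle basis vectors, which is not zero as 2 < n, and a nilpotent
matrix has a kernel there. For n = 2 and A = E_01 the equation is minus the
square of the coordinate, and the conclusion fails. *)
Lemma differential_corner m : A ^+ m = 0 -> (2 < n)%N ->
  differential h 0 (coords (delta_mx l o)) = 0.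
Proof.
move=> Am0 n_gt2.
have [/existsP[k /and3P[ko kl Aok]]|/existsPn Ao] :=
  boolP [exists k, [&& k != o, k != l & A o k != 0]].
  exact: (differential_corner_col ko kl Aok).
have [/existsP[k /and3P[ko kl Akl]]|/existsPn Al] :=
  boolP [exists k, [&& k != o, k != l & A k l != 0]].
  exact: (differential_corner_row ko kl Akl).
have Ao0 k : k != l -> A o k = 0.
  move=> kl; have [->|ko] := eqVneq k o; first exact: Acol.
  by apply/eqP; have := Ao k; rewrite ko kl /= negbK.
have lt1n : (1 < n)%N by lia.
pose k1 := Ordinal lt1n.
have k1o : k1 != o by rewrite -val_eqE /= o0.
have k1l : k1 != l by rewrite -val_eqE /=; lia.
have [|||y [my nz_y Ay0]] := @nilpotent_kernel _ _ middle_col _ _ Am0 _ (1 *: delta_mx k1 0).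
- move=> y [yo yl]; split; rewrite mxE big1 // => i _; last by rewrite Arow mul0r.
  by have [->|/Ao0->] := eqVneq i l; rewrite ?yl ?mulr0 ?mul0r.
- exact: middle_delta_col.
- rewrite scale1r; apply/eqP => /colP/(_ k1)/eqP; by rewrite !mxE !eqxx oner_eq0.
have /existsP[k yk] : [exists k, y k 0 != 0].
  apply: contraNT nz_y => /existsPn y0; apply/eqP/colP => k; rewrite mxE.
  by apply/eqP; have := y0 k; rewrite negbK.
apply: (differential_corner_parabola my Ay0 yk); apply/eqP; have := Al k.
have -> : k != o by apply: contraNneq yk => ->; rewrite (proj1 my).
have -> : k != l by apply: contraNneq yk => ->; rewrite (proj2 my).
by rewrite /= negbK.
Qed.

Lemma vanishing_ideal_differential m w : A ^+ m = 0 -> (2 < n)%N ->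
  differential h 0 w = 0.
Proof.
move=> Am0 n_gt2; rewrite /differential big1 // => c _.
suff -> : (h^`M(c)).@[(0 : 'rV[K]_N) 0] = 0 by rewrite mul0r.
transitivity (differential h 0 (coords (delta_mx (enum_val c).1 (enum_val c).2))).
  rewrite /differential (bigD1 c) //= !mxE !eqxx mulr1 big1 ?addr0 // => c' ne_c.
  rewrite !mxE -[_ && _]/(enum_val c' == enum_val c) (inj_eq enum_val_inj).
  by rewrite (negPf ne_c) mulr0.
have [eq_lo|ne_c] := eqVneq (enum_val c) (l, o).
  by rewrite eq_lo; apply: (differential_corner Am0).
apply: differential_entry; first exact: (enum_valP c).
by rewrite -surjective_pairing.
Qed.

End VanishingIdeal.

(** Each entry of A off the first column and the last row is, up to sign and
earlier entries, a value of the corner at a hook, by [hook_corner]. *)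
Lemma corner_nonzero : A != 0 -> exists v, corner v != 0.
Proof.
move=> nz_A; apply: contrapT => no_v.
have c0 v : corner v = 0.
  by apply/eqP/negPn/negP => cv; apply: no_v; exists v.
have m0c : middle_col 0 by split; rewrite mxE.
have m0r : middle_row 0 by split; rewrite mxE.
have Aol : A o l = 0.
  have := c0 (0 *: coords (hook 0 0) + 1 *: coords (delta_mx l o)).
  rewrite hook_corner // !mul0mx !mxE => H.
  by apply/eqP; rewrite -oppr_eq0 -H; apply/eqP; ring.
have Ao j : A o j = 0.
  have [->|jo] := eqVneq j o; first exact: Acol.
  have [->|jl] := eqVneq j l; first exact: Aol.
  have := c0 (1 *: coords (hook (1 *: delta_mx j 0) 0) + 1 *: coords (delta_mx l o)).
  rewrite hook_corner //; last exact: middle_delta_col.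
  rewrite !mul0mx scale1r -colE !mxE Aol => H.
  by apply/eqP; rewrite -oppr_eq0 -H; apply/eqP; ring.
case/eqP: nz_A; apply/matrixP => i j; rewrite mxE.
have [->|io] := eqVneq i o; first exact: Ao.
have [->|il] := eqVneq i l; first exact: Arow.
have [->|jo] := eqVneq j o; first exact: Acol.
have mri : middle_row (1 *: delta_mx 0 i) by apply: middle_delta_row.
have [->|jl] := eqVneq j l.
  have := c0 (1 *: coords (hook 0 (1 *: delta_mx 0 i)) + 1 *: coords (delta_mx l o)).
  rewrite hook_corner // !mulmx0 scale1r -rowE !mxE Aol => H.
  by apply/eqP; rewrite -oppr_eq0 -H; apply/eqP; ring.
have := c0 (1 *: coords (hook (1 *: delta_mx j 0) (1 *: delta_mx 0 i))
            + 0 *: coords (delta_mx l o)).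
rewrite hook_corner //; last exact: middle_delta_col.
rewrite !scale1r -rowE -!colE !mxE !Ao => H.
by apply/eqP; rewrite -oppr_eq0 -H; apply/eqP; ring.
Qed.

(** The tangent space has dimension N by [vanishing_ideal_differential], and no
chain of primes containing f has length N. *)
Lemma corner_singular_point m (Z : set 'rV[K]_N) : A ^+ m = 0 -> A != 0 -> (2 < n)%N ->
  (forall v, Z v <-> corner v = 0) -> singular_point Z 0.
Proof.
move=> Am0 nz_A n_gt2 ZE.
split; first by apply/ZE; rewrite conj_by_lower_unip0 Arow.
case=> _ [d [[chain _] [U tanU dimU]]].
have fZ : vanishing_ideal Z (generic_conj A l o).
  by move=> v /ZE cv; rewrite generic_conj_eval.
have nz_f : generic_conj A l o != 0.
  have [v cv] := corner_nonzero nz_A; apply: contra cv => /eqP f0.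
  by rewrite -generic_conj_eval f0 meval0.
have := prime_chain_hypersurface fZ nz_f chain.
have U_full : U = fullv.
  apply/vspaceP => w; rewrite memvf; apply/tanU => h hZ.
  exact: (vanishing_ideal_differential ZE hZ w Am0 n_gt2).
rewrite -dimU U_full dimvf dim_matrix mul1r.
by rewrite ltnn.
Qed.
End Singular.

(** * The two Hessenberg varieties *)

Section CornerConditions.
Variables (K : numFieldType) (n : nat).

Lemma m_max_mono (i j : 'I_n) : (i <= j)%N -> (m_max i <= m_max j)%N.
Proof. by rewrite /m_max => le_ij; do 2?case: eqP => //= *; lia. Qed.

Lemma m_sing_mono (i j : 'I_n) : (i <= j)%N -> (m_sing i <= m_sing j)%N.
Proof.
have [_ _ mono] := m_sing_hessenberg (leq_ltn_trans (leq0n _) (ltn_ord i)).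
exact: mono.
Qed.

Lemma hess_max_corner (A : 'M[K]_n) (o l : 'I_n) : o = 0%N :> nat -> l.+1 = n -> l != o ->
  hess_space (@m_max n) A <-> A l o = 0.
Proof.
move=> o0 l_last ne_lo; split=> [hA|Alo i j].
  by apply: hA; rewrite /m_max o0 /=; lia.
rewrite /m_max; have ltin := ltn_ord i; case: eqP => [j0|_] lt_i; last by lia.
have -> : j = o by apply/val_inj; rewrite /= j0 o0.
by have -> : i = l by apply/val_inj; rewrite /=; lia.
Qed.

Lemma hess_singE (A : 'M[K]_n) (o l : 'I_n) : o = 0%N :> nat -> l.+1 = n -> l != o ->
  hess_space (@m_sing n) A <->
  (forall i, i != o -> A i o = 0) /\ (forall j, j != l -> A l j = 0).
Proof.
move=> o0 l_last ne_lo; have l0 : (l : nat) <> 0%N by rewrite -o0 => /val_inj; apply/eqP.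
split=> [hA|[Aco Arow] i j].
  split=> [i io|j jl]; apply: hA; rewrite /m_sing.
    by rewrite o0 /= ltnS lt0n -o0 val_eqE.
  case: eqP => [_|j0]; first by lia.
  case: eqP => [j_last|_]; last by lia.
  by case/eqP: jl; apply/val_inj => /=; lia.
rewrite /m_sing; have ltin := ltn_ord i; case: eqP => [j0|j0].
  have -> : j = o by apply/val_inj; rewrite /= j0 o0.
  by move=> i1; apply: Aco; rewrite -val_eqE /= o0; lia.
case: eqP => [|j_last lt_i]; first by lia.
have -> : i = l by apply/val_inj; rewrite /=; lia.
by apply: Arow; rewrite -val_eqE /=; apply/eqP; lia.
Qed.

End CornerConditions.

Theorem theorem5 (R : realType) (n : nat) (x : 'M[R[i]]_n) (n_gt0 : (0 < n)%N) :
  (singular_locus (hess_variety x (@m_max n)) `<=` hess_variety x (@m_sing n))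
  /\
  ((2 < n)%N -> x <> 0 -> (exists k : nat, x ^+ k = 0) ->
     singular_locus (hess_variety x (@m_max n)) = hess_variety x (@m_sing n)).
Proof.
pose o : 'I_n := Ordinal n_gt0; pose l : 'I_n := rev_ord o.
have o0 : o = 0%N :> nat by [].
have l_last : l.+1 = n by rewrite /=; lia.
have chartE g v : l != o -> g \in unitmx -> chart g (hess_variety x (@m_max n)) v <->
    conj_by (conj_by x g) (lower_unip v) l o = 0.
  move=> ne_lo ug; rewrite -(hess_max_corner _ o0 l_last ne_lo) -conj_byM ?lower_unip_unit //.
  by apply: hess_varietyE; [apply: m_max_mono | rewrite unitmx_mul ug lower_unip_unit].
have sing_sub : singular_locus (hess_variety x (@m_max n)) `<=` hess_variety x (@m_sing n).
  move=> _ [g [ug [Z0 not_reg]] <-].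
  apply/(hess_varietyE _ (@m_sing_mono n) ug).
  (* For n = 1 the second variety is the whole flag variety. *)
  have [eq_lo|ne_lo] := eqVneq l o.
    move=> i j; have := ltn_ord i; rewrite /m_sing.
    have := congr1 val eq_lo; have := ltn_ord j; rewrite /=.
    by do 2?case: eqP => *; lia.
  have Z0' : conj_by x g l o = 0.
    by move/(chartE _ _ ne_lo ug): Z0; rewrite conj_by_lower_unip0.
  have reg k : k != o -> k != l -> conj_by x g k o = 0 /\ conj_by x g l k = 0.
    move=> ko kl; apply: contrapT => not0; apply: not_reg.
    apply: (corner_regular_point o0 l_last ko kl Z0'); last by move=> v; apply: chartE.
    have [Ako|] := eqVneq (conj_by x g k o) 0; last by left.
    by right; apply/eqP => Alk; apply: not0.
  apply/(hess_singE _ o0 l_last ne_lo); split=> [i io|j jl].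
    by have [->//|il] := eqVneq i l; have [] := reg i io il.
  by have [->//|jo] := eqVneq j o; have [] := reg j jo jl.
split=> // n_gt2 /eqP nz_x [m xm0]; apply/seteqP; split=> // _ [g [ug hg] <-].
have ne_lo : l != o by rewrite -val_eqE /=; lia.
exists g => //; split=> //; set A := conj_by x g.
have Am0 : A ^+ m = 0 by rewrite conj_by_exp // xm0 /conj_by mulmx0 mul0mx.
have nz_A : A != 0.
  apply: contra nz_x => /eqP A0; apply/eqP.
  by rewrite -[x](mulKVmx ug) -[_ *m x](mulmxK ug) -/(conj_by x g) -/A A0 mul0mx mulmx0.
have [Acol Arow] := (hess_singE A o0 l_last ne_lo).1 hg.
apply: (corner_singular_point o0 l_last ne_lo _ _ Am0 nz_A n_gt2).
- exact: nilpotent_col Am0 Acol.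
- exact: nilpotent_row Am0 Arow.
by move=> v; apply: chartE.
Qed.
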